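(* Let $X$ be a compact nonempty subset of $\mathbb{R}^n$, let $h_1,\dots,h_m\in\mathbb{R}[x_1,\dots,x_n]$ and $b=(b_1,\dots,b_m)\in\mathbb{R}^m$, and let $\mu$ be a strictly positive Borel probability measure on $X$. Assume that $h_1\equiv 1$, $b_1>0$, and that $b$ is in the relative interior of $$K=\Big\{\Big(\int_X h_i\,d\eta\Big)_{i=1,\dots,m}\ \Big|\ \eta\in\mathcal{M}_+(X)\Big\}.$$ Then there exists $\nu\in\mathcal{M}_+(X)$ with $\int_X h_i\,d\nu=b_i$ for all $i=1,\dots,m$, such that $\nu\ll\mu$ and the Radon–Nikodym derivative $\frac{d\nu}{d\mu}$ is of the form $c\exp\big(\sum_{i=1}^m\kappa_i h_i\big)$ for some real constant $c>0$ and some $\kappa\in\mathbb{R}^m$.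
   Context: $\mathcal{M}_+(X)$ is the set of finite nonnegative Borel measures on $X$. A measure $\mu$ on $X$ is strictly positive if $\mu(U)>0$ for every nonempty (relatively) open subset $U$ of $X$. Relative interior means interior within the affine hull. $\nu\ll\mu$ means that $\nu$ is absolutely continuous with respect to $\mu$. *)

(* Defs.v *)
From HB Require Import structures.
From mathcomp Require Import all_boot all_order all_algebra.
From mathcomp Require Import all_classical all_reals all_analysis.
(* The notations of mpoly clash with those of mathcomp-analysis. *)
From mathcomp Require Import -(notations) mpoly.

Set Implicit Arguments.
Unset Strict Implicit.
Unset Printing Implicit Defensive.

Import Order.TTheory GRing.Theory Num.Theory.
Import numFieldNormedType.Exports.

Local Open Scope classical_set_scope.
Local Open Scope ring_scope.

(* A nonempty subset of a topological space, as a topological space of its own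
   (subspace topology) with its Borel sigma-algebra. The proof of nonemptiness
   only serves to provide the point required by measurableType. *)
Definition borel_subset (T : topologicalType) (X : set T) (X0 : X !=set0) : Type
  := set_type X.

Section borel_subset_instances.
Variables (T : topologicalType) (X : set T) (X0 : X !=set0).

HB.instance Definition _ := Topological.copy (borel_subset X0) (set_type X).
HB.instance Definition _ := isPointed.Build (borel_subset X0)
  (exist (fun x => x \in X) (projT1 (cid X0)) (mem_set (projT2 (cid X0)))).
HB.instance Definition _ := Measurable.copy (borel_subset X0)
  (g_sigma_algebraType (@open (borel_subset X0))).

End borel_subset_instances.

Definition strictly_positive (R : realType) (T : topologicalType) (X : set T)
    (X0 : X !=set0) (mu : set (borel_subset X0) -> \bar R) : Prop :=
  forall U : set (borel_subset X0), open U -> U !=set0 -> (0 < mu U)%E.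

Definition affine_hull (R : realType) (V : lmodType R) (A : set V) : set V :=
  [set v | exists (k : nat) (a : 'I_k -> V) (t : 'I_k -> R),
    [/\ forall i, A (a i), \sum_i t i = 1 & v = \sum_i t i *: a i]].

(* In the topology of [subspace D], the points outside of D are isolated; since
   A is contained in its affine hull this does not add any point here. *)
Definition relative_interior (R : realType) (V : normedModType R) (A : set V)
    : set V :=
  @interior (subspace (affine_hull A)) A.

Section moments.
Variables (R : realType) (n : nat) (X : set 'rV[R]_n) (X0 : X !=set0).

Definition poly_fun (p : mpoly n R) (x : borel_subset X0) : R :=
  meval (fun j => (val x : 'rV[R]_n) ord0 j) p.

Definition moments (m : nat) (h : 'I_m -> mpoly n R)
    (eta : {finite_measure set (borel_subset X0) -> \bar R}) : 'rV[R]_m :=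
  \row_i \int[eta]_x poly_fun (h i) x.

Definition moment_cone (m : nat) (h : 'I_m -> mpoly n R) : set 'rV[R]_m :=
  range (moments h).

End moments.

(* Main.v *)
(* The density is found by convex duality. One minimizes
     J(th) = \int exp(th . h) dmu - th . b,
   whose stationarity condition is exactly \int h_i exp(th . h) dmu = b_i.
   Replacing h by its coordinates g in a basis of the span of h(X), only th = 0
   satisfies th . g = 0 on X. Then J tends to infinity along every ray: either
   th . g > 0 on a nonempty open set, which mu charges, and the exponential
   term wins; or th . g <= 0 with th . g < 0 somewhere, and th . b < 0 because
   b is a relative interior point of the moment cone. By convexity along rays
   and compactness of the unit sphere, J is coercive, so a minimizer exists. *)
Require Import Defs.
From HB Require Import structures.
From mathcomp Require Import all_boot all_order all_algebra.
From mathcomp Require Import all_classical all_reals all_analysis.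
From mathcomp Require Import measurable_realfun.
From mathcomp Require Import ring lra.
From mathcomp Require Import -(notations) mpoly.

Set Implicit Arguments.
Unset Strict Implicit.
Unset Printing Implicit Defensive.

Import Order.TTheory GRing.Theory Num.Theory.
Import numFieldNormedType.Exports.

Local Open Scope classical_set_scope.
Local Open Scope ring_scope.
Local Open Scope charge_scope.

(** * The dot product of row vectors and its bound by sup norms *)

Section dot_product.
Context {R : realType} {r : nat}.
Implicit Types (u v : 'rV[R]_r) (a : R).

Definition dot u v : R := (u *m v^T) ord0 ord0.

Lemma dotE u v : dot u v = \sum_j u ord0 j * v ord0 j.
Proof. by rewrite /dot mxE; apply: eq_bigr => j _; rewrite mxE. Qed.

Lemma dot0l v : dot 0 v = 0. Proof. by rewrite /dot mul0mx mxE. Qed.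

Lemma dotDl u1 u2 v : dot (u1 + u2) v = dot u1 v + dot u2 v.
Proof. by rewrite /dot mulmxDl mxE. Qed.

Lemma dotBl u1 u2 v : dot (u1 - u2) v = dot u1 v - dot u2 v.
Proof. by rewrite /dot mulmxBl !mxE. Qed.

Lemma dotZl a u v : dot (a *: u) v = a * dot u v.
Proof. by rewrite /dot -scalemxAl mxE. Qed.

Lemma dotNl u v : dot (- u) v = - dot u v.
Proof. by rewrite /dot mulNmx mxE. Qed.

Lemma dotC u v : dot u v = dot v u.
Proof. by rewrite !dotE; apply: eq_bigr => j _; rewrite mulrC. Qed.

Lemma mx_entry_le_norm u j : `|u ord0 j| <= `|u|.
Proof.
rewrite [leRHS]/Num.norm/= mx_normrE.
exact: (@le_bigmax _ _ _ (0:R) (fun ij : 'I_1 * 'I_r => `|u ij.1 ij.2|) (ord0, j)).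
Qed.

Lemma mx_norm_le u a : 0 <= a -> (forall j, `|u ord0 j| <= a) -> `|u| <= a.
Proof.
move=> a0 ua; rewrite [leLHS]/Num.norm/= mx_normrE.
by apply: bigmax_le => // -[i j] _; rewrite ord1.
Qed.

Lemma dot_norm_le u v : `|dot u v| <= r%:R * `|v| * `|u|.
Proof.
rewrite dotE (le_trans (ler_norm_sum _ _ _))//.
have -> : r%:R * `|v| * `|u| = \sum_(j < r) `|u| * `|v|.
  by rewrite sumr_const card_ord -[RHS]mulr_natl -mulrA [`|v| * _]mulrC.
by apply: ler_sum => j _; rewrite normrM ler_pM// mx_entry_le_norm.
Qed.

Lemma dotl_continuous v : continuous (dot^~ v).
Proof.
move=> u; rewrite (_ : dot^~ v = fun u => \sum_j u ord0 j * v ord0 j); last first.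
  by apply/funext => u'; rewrite dotE.
apply: continuous_big => [|j _ w]; first exact: add_continuous.
have c : continuous (fun w : 'rV[R]_r => w ord0 j).
  exact: (@coord_continuous R 1 r ord0 j).
exact: cvgM (c w) (cvg_cst _).
Qed.

End dot_product.

Lemma dot_mulmx (R : realType) (r s : nat) (u : 'rV[R]_r) (v : 'rV[R]_s) (Q : 'M[R]_(s, r)) :
  dot u (v *m Q) = dot (u *m Q^T) v.
Proof. by rewrite /dot trmx_mul mulmxA. Qed.

Lemma mulmx_rowE (R : realType) (r s : nat) (v : 'rV[R]_s) (Q : 'M[R]_(s, r)) j :
  (v *m Q) ord0 j = dot (col j Q)^T v.
Proof. by rewrite dotE mxE; apply: eq_bigr => i _; rewrite !mxE mulrC. Qed.

(** * Elementary inequalities for the exponential, and a first-order test *)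

Section exp_lemmas.
Context {R : realType}.
Implicit Types a s t : R.

(** Factor [expR (s * a)] out of the right-hand side and bound both remaining exponentials below by
    their tangent [1 + x]; with weights [s] and [1 - s] the linear terms cancel. *)
Lemma expR_convex0 s a : 0 <= s <= 1 -> expR (s * a) <= s * expR a + (1 - s).
Proof.
move=> /andP[s0 s1].
have E1 : expR a = expR (s * a) * expR ((1 - s) * a).
  by rewrite -expRD; congr expR; ring.
have E2 : 1 = expR (s * a) * expR (- (s * a)) by rewrite -expRD subrr expR0.
have := expR_ge1Dx ((1 - s) * a); have := expR_ge1Dx (- (s * a)).
move=> h2 h1; have p := expR_gt0 (s * a).
rewrite E1 -[X in _ <= _ + X]mul1r [X in X * (1 - s)]E2.
set e := expR (s * a) in p *.
apply: (@le_trans _ _ (s * (e * (1 + (1 - s) * a)) + e * (1 + - (s * a)) * (1 - s))).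
  by rewrite le_eqVlt; apply/orP; left; apply/eqP; ring.
apply: lerD.
  by apply: ler_wpM2l => //; rewrite ler_pM2l.
by apply: ler_wpM2r; rewrite ?subr_ge0// ler_pM2l.
Qed.

(** From exp(-s) >= 1 - s one gets exp(s) (1 - s) <= 1, while (1 + s + 2 s^2)(1 - s) = 1 + s^2 (1 -
    2 s) >= 1 for s <= 1/2. *)
Lemma expR_le_quad s : `|s| <= 2^-1 -> expR s <= 1 + s + 2 * s ^+ 2.
Proof.
move=> s2; have /ler_normlP[sa sb] := s2.
have := expR_ge1Dx (- s); have p := expR_gt0 s => h.
have E : expR s * expR (- s) = 1 by rewrite -expRD subrr expR0.
have h2 : expR s * (1 - s) <= 1 by rewrite -[leRHS]E ler_pM2l.
have h3 : 1 <= (1 + s + 2 * s ^+ 2) * (1 - s) by nra.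
have h4 : 0 < 1 - s by lra.
by rewrite -(ler_pM2r h4) (le_trans h2).
Qed.

Lemma expR_ge_quad s : 0 <= s -> s ^+ 2 / 2 <= expR s.
Proof.
move=> s0; have := expR_ge1Dxn 1 s0; rewrite (_ : 2`! = 2)%N// => h; lra.
Qed.

Lemma first_order_eq0 (e a c : R) : 0 < e -> 0 <= c ->
  (forall t, `|t| <= e -> 0 <= t * a + t ^+ 2 * c) -> a = 0.
Proof.
move=> e0 c0 H; apply: contrapT => /eqP a0.
(* The test point is [- (t * a)]: the first bound keeps it in the allowed range, the second forces t
   c < 1, so that t a^2 (t c - 1) < 0. *)
pose t := Num.min (e / `|a|) (1 / (1 + c)).
have na : 0 < `|a| by rewrite normr_gt0.
have c1 : 0 < 1 + c by lra.
have t0 : 0 < t by rewrite lt_min !divr_gt0.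
have t1 : t * `|a| <= e by rewrite -ler_pdivlMr// ge_min lexx.
have t2 : t * (1 + c) <= 1 by rewrite -ler_pdivlMr// ge_min lexx orbT.
have := H (- (t * a)); rewrite normrN normrM (gtr0_norm t0) => /(_ t1).
have a2 : 0 < a ^+ 2 by rewrite exprn_even_gt0//= a0.
rewrite (_ : _ + _ = (t * a ^+ 2) * (t * c - 1)); last by ring.
by rewrite (pmulr_rge0 _ (mulr_gt0 t0 a2)) => h; lra.
Qed.

End exp_lemmas.

Lemma expR_dist_cvg (R : realType) (V : normedModType R) (x : V) (a : R) :
  expR (a * `|y - x|) @[y --> x] --> (1 : R).
Proof.
have c0 : (y - x) @[y --> x] --> x - x.
  by apply: cvgB; [exact: cvg_id|exact: cvg_cst].
have c1 : a * `|y - x| @[y --> x] --> a * `|x - x|.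
  by apply: cvgM; [exact: cvg_cst|exact: cvg_norm].
have : expR (a * `|y - x|) @[y --> x] --> expR (a * `|x - x|).
  by apply: continuous_cvg => //; exact: continuous_expR.
by rewrite subrr normr0 mulr0 expR0.
Qed.

Lemma bounded_integrable d (T : measurableType d) (R : realType)
    (mu : {finite_measure set T -> \bar R}) (f : T -> R) (C : R) :
  measurable_fun setT f -> (forall x, `|f x| <= C) ->
  mu.-integrable setT (EFin \o f).
Proof.
move=> mf fC; apply: measurable_bounded_integrable => //.
  by rewrite ltey_eq fin_num_measure.
by exists C; split => [|y Cy x _]; [exact: num_real|exact: le_trans (fC x) (ltW Cy)].
Qed.

(** * The exponential integral of a bounded measurable map [g] *)

Section log_partition.
Context d (T : measurableType d) (R : realType).
Variables (mu : {finite_measure set T -> \bar R}) (r : nat).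
Variables (g : T -> 'rV[R]_r) (M : R).
Hypothesis mg : forall j, measurable_fun setT (fun x => g x ord0 j).
Hypothesis gM : forall x, `|g x| <= M.
Implicit Types (th v : 'rV[R]_r).

Lemma measurable_dot v : measurable_fun setT (fun x => dot v (g x)).
Proof.
under eq_fun do rewrite dotE.
by apply: measurable_sum => j; apply: measurable_funM.
Qed.

Lemma measurable_dot_gt v (a : R) : measurable [set x | a < dot v (g x)].
Proof.
rewrite -[X in measurable X]setTI.
have := measurable_dot v measurableT (measurable_itv `]a, +oo[).
by congr (measurable (_ `&` _)); apply/seteqP; split => x /=; rewrite in_itv/= andbT.
Qed.

Lemma dot_bound v x : `|dot v (g x)| <= r%:R * M * `|v|.
Proof.
rewrite (le_trans (dot_norm_le _ _))//.
by apply: ler_wpM2r => //; apply: ler_wpM2l.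
Qed.

Lemma measurable_expdot th : measurable_fun setT (fun x => expR (dot th (g x))).
Proof. by apply: measurableT_comp => //; exact: measurable_dot. Qed.

Lemma expdot_bound th x : `|expR (dot th (g x))| <= expR (r%:R * M * `|th|).
Proof.
by rewrite ger0_norm ?expR_ge0// ler_expR (le_trans (ler_norm _))// dot_bound.
Qed.

Lemma integrable_expdot th :
  mu.-integrable setT (EFin \o (fun x => expR (dot th (g x)))).
Proof.
exact: bounded_integrable (measurable_expdot _) (expdot_bound _).
Qed.

Lemma integrable_expdotM th (f : T -> R) (C : R) :
  measurable_fun setT f -> (forall x, `|f x| <= C) ->
  mu.-integrable setT (EFin \o (fun x => expR (dot th (g x)) * f x)).
Proof.
move=> mf fC; apply: (@bounded_integrable _ _ _ _ _ (expR (r%:R * M * `|th|) * C)).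
  by apply: measurable_funM => //; exact: measurable_expdot.
by move=> x; rewrite normrM ler_pM// expdot_bound.
Qed.

(** This is the Laplace transform of the image of [mu] under [g]. *)
Definition partition_fun th : R := \int[mu]_x expR (dot th (g x)).
Local Notation Z := partition_fun.

Lemma partition_fun_ge0 th : 0 <= Z th.
Proof. by apply: Rintegral_ge0 => x _; exact: expR_ge0. Qed.

(** Pointwise, th'.g <= th.g + r M |th' - th|. Used in both directions, this yields continuity
    without dominated convergence. *)
Lemma partition_fun_le th th' :
  Z th' <= expR (r%:R * M * `|th' - th|) * Z th.
Proof.
rewrite /partition_fun -RintegralZl//; last exact: integrable_expdot.
apply: le_Rintegral => //; first exact: integrable_expdot.
  apply: (@eq_integrable _ _ _ _ _ measurableT
    (EFin \o (fun x => expR (dot th (g x)) * expR (r%:R * M * `|th' - th|)))) => //.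
    by move=> x _ /=; rewrite mulrC.
  apply: (@integrable_expdotM th (fun=> _) (expR (r%:R * M * `|th' - th|))) => //.
  by move=> _; rewrite ger0_norm// expR_ge0.
move=> x _; rewrite -expRD ler_expR -lerBlDr -dotBl.
by rewrite (le_trans (ler_norm _))// dot_bound.
Qed.

Lemma partition_fun_continuous : continuous Z.
Proof.
move=> th.
have cE (a : R) : expR (a * `|th' - th|) * Z th @[th' --> th] --> Z th.
  have := cvgM (expR_dist_cvg th a) (cvg_cst (Z th)); rewrite mul1r; exact.
apply: (squeeze_cvgr _ (cE (- (r%:R * M))) (cE (r%:R * M))).
near=> th'; rewrite partition_fun_le andbT mulNr.
(* The lower bound is the upper one with [th] and [th'] exchanged. *)
rewrite -(ler_pM2l (expR_gt0 (r%:R * M * `|th' - th|))) mulrA -expRD subrr expR0.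
by rewrite mul1r distrC partition_fun_le.
Unshelve. all: by end_near. Qed.

Lemma partition_fun_ray th (s : R) : 0 <= s <= 1 ->
  Z (s *: th) <= s * Z th + (1 - s) * Z 0.
Proof.
move=> s01; rewrite /partition_fun -!RintegralZl//; try exact: integrable_expdot.
have iZ c th1 : mu.-integrable setT (EFin \o (fun x => c * expR (dot th1 (g x)))).
  by have := integrableZl measurableT c (integrable_expdot th1).
rewrite -RintegralD//; apply: le_Rintegral => //; first exact: integrable_expdot.
  have := integrableD measurableT (iZ s th) (iZ (1 - s) 0).
  exact: eq_integrable.
by move=> x _; rewrite dotZl dot0l expR0 mulr1; exact: expR_convex0.
Qed.

(** Keep only the part of the integral over the set where th.g > dl; there the exponential is at
    least (t dl)^2 / 2. Quadratic growth in [t] is enough to beat the linear term of [J]. *)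
Lemma partition_fun_growth th (dl t : R) : 0 <= dl -> 0 <= t ->
  (t * dl) ^+ 2 / 2 * fine (mu [set x | dl < dot th (g x)]) <= Z (t *: th).
Proof.
move=> dl0 t0; set U := [set x | _].
have mU : measurable U := measurable_dot_gt th dl.
rewrite -Rintegral_cst// Rintegral_mkcond.
apply: le_Rintegral => //; last 1 first.
- move=> x _; rewrite patchE; case: ifPn => [|_]; last exact: expR_ge0.
  rewrite inE /U/= => h; rewrite dotZl.
  apply: (le_trans (expR_ge_quad (mulr_ge0 t0 dl0))).
  by rewrite ler_expR ler_wpM2l// ltW.
- apply: (@bounded_integrable _ _ _ _ _ (`|(t * dl) ^+ 2 / 2|)).
    by apply/(measurable_restrictT _ mU).
  by move=> x; rewrite patchE; case: ifP => // _; rewrite normr0.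
- exact: integrable_expdot.
Qed.

(** * The dual functional [J]: coercivity, minimizer, stationarity *)

Variable beta : 'rV[R]_r.

Definition dual_fun th : R := Z th - dot th beta.
Local Notation J := dual_fun.

Lemma dual_fun0 : J 0 = Z 0. Proof. by rewrite /dual_fun dot0l subr0. Qed.

Lemma dual_fun_continuous : continuous J.
Proof.
move=> th.
have := cvgB (@partition_fun_continuous th) (@dotl_continuous _ _ beta th); exact.
Qed.

Lemma dual_fun_ray th (s : R) : 0 <= s <= 1 ->
  J (s *: th) <= s * J th + (1 - s) * J 0.
Proof.
move=> s01; rewrite dual_fun0 /dual_fun dotZl.
move: (partition_fun_ray th s01) => h.
by rewrite mulrBr addrAC lerB.
Qed.

(** By convexity, since [th] lies between 0 and [t *: th] with weight 1/t: once [J] exceeds [J 0] on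
    a ray, it does so from there on. *)
Lemma dual_fun_ray_gt th (t : R) : 1 <= t -> J 0 < J th -> J 0 < J (t *: th).
Proof.
move=> t1; have t0 : 0 < t by lra.
rewrite !ltNge; apply: contra => h.
have s01 : 0 <= t^-1 <= 1 by rewrite invr_ge0 ltW//= invf_le1.
have := dual_fun_ray (t *: th) s01.
rewrite scalerA mulVf ?gt_eqF// scale1r => /le_trans; apply.
have : t^-1 * J (t *: th) <= t^-1 * J 0 by rewrite ler_pM2l ?invr_gt0.
by move=> ?; lra.
Qed.

Lemma dual_fun_unbounded th :
  (exists2 dl : R, 0 < dl & (0 < mu [set x | (dl < dot th (g x))%R])%E) \/
    dot th beta < 0 ->
  exists2 t : R, 0 < t & J 0 < J (t *: th).
Proof.
move=> [[dl dl0 U0]|c0]; last first.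
  (* This [t] makes the linear term of [J] equal to Z 0 + 1, and Z >= 0. *)
  exists ((Z 0 + 1) / - dot th beta).
    by rewrite divr_gt0//; [have := partition_fun_ge0 0|]; lra.
  rewrite dual_fun0 /dual_fun dotZl.
  have -> : (Z 0 + 1) / - dot th beta * dot th beta = - (Z 0 + 1).
    by field; rewrite lt_eqF.
  by rewrite opprK ltr_wpDl ?partition_fun_ge0// ltrDl.
set p := fine (mu [set x | dl < dot th (g x)]).
have p0 : 0 < p.
  rewrite fine_gt0// U0/= ltey_eq fin_num_measure//.
  exact: measurable_dot_gt.
pose k := dl ^+ 2 / 2 * p.
have k0 : 0 < k by rewrite mulr_gt0// divr_gt0// exprn_gt0.
(* Chosen so that k t = k + |th.beta| + Z 0: the quadratic term k t^2 then exceeds t th.beta by at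
   least t (k + Z 0), which is more than Z 0 as t >= 1. *)
pose t := 1 + (`|dot th beta| + Z 0) / k.
have Z0 := partition_fun_ge0 0.
have q0 : 0 <= (`|dot th beta| + Z 0) / k by apply: divr_ge0; [exact: addr_ge0|exact: ltW].
have t0 : 0 < t by rewrite /t; lra.
exists t => //; rewrite dual_fun0 /dual_fun dotZl.
have := partition_fun_growth th (ltW dl0) (ltW t0); rewrite -/p => h.
have kt : k * t = k + `|dot th beta| + Z 0 by rewrite mulrDr mulr1 mulrCA mulfV ?gt_eqF// mulr1 addrA.
have e : (t * dl) ^+ 2 / 2 * p = t * (k * t) by rewrite /k; ring.
have h1 := ler_norm (dot th beta).
rewrite e kt in h.
have h2 : t * dot th beta <= t * `|dot th beta| by rewrite ler_pM2l.
have h3 : Z 0 <= t * Z 0 by apply: (ler_peMl Z0); rewrite lerDl; exact: q0.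
have h4 : 0 < t * k by exact: mulr_gt0.
clear e kt q0 Z0 t0; clearbody t k p.
move: h h1 h2 h3 h4; move: (Z 0) (Z (t *: th)) (dot th beta) => z0 z1 c *; lra.
Qed.

(** The dichotomy on directions, kept abstract here; the theorem derives it from strict positivity
    and the relative interior. *)
Hypothesis coer : forall th, th != 0 ->
  (exists2 dl : R, 0 < dl & (0 < mu [set x | (dl < dot th (g x))%R])%E) \/
    dot th beta < 0.

(** For each unit direction some multiple has J > J 0; by continuity the same multiple works for
    nearby directions, and larger ones work by convexity. Compactness of the sphere makes the
    threshold uniform. *)
Lemma dual_fun_coercive :
  exists2 rho, 0 < rho & forall th, rho <= `|th| -> J 0 < J th.
Proof.
pose S := [set th : 'rV[R]_r | `|th| = 1].
have cS : compact S.
  apply: bounded_closed_compact.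
    by exists 1; split => [|y y1 th /= ->]; [exact: num_real|exact: ltW].
  apply: (closed_comp (f := fun th : 'rV[R]_r => `|th|) (D := [set 1])).
    by move=> th _; exact: norm_continuous.
  exact: closed_eq.
have /compact_near_coveringP/(_ R (pinfty_nbhs R)
  (fun t th => J 0 < J (t *: th))) nS := cS.
have [|rho [rr rhoP]] := nS _; first move=> th Sth.
  have th0 : th != 0 by rewrite -normr_eq0 Sth oner_eq0.
  have [t t0 Jt] := dual_fun_unbounded (coer th0).
  near=> th' s => /=.
  (* Since s / t >= 1, convexity along the ray reduces the claim to the fixed multiple [t]. *)
  have -> : s *: th' = (s / t) *: (t *: th').
    by rewrite scalerA divfK ?gt_eqF.
  apply: dual_fun_ray_gt.
    by rewrite ler_pdivlMr// mul1r.
  near: th'.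
  have c0 : t *: x @[x --> th] --> t *: th := @scaler_continuous _ _ t th.
  have ct := continuous_cvg _ (@dual_fun_continuous (t *: th)) c0.
  exact: (cvgr_gt _ (ct _)).
(* The threshold [rho] is only valid for strictly larger radii, hence the shift; the bound 1 allows
   dividing by the norm. *)
exists (Num.max 1 (rho + 1)); first by rewrite lt_max ltr01.
move=> th; rewrite ge_max => /andP[th1 thr].
have nth0 : `|th| != 0 by rewrite gt_eqF//; lra.
have -> : th = `|th| *: (`|th|^-1 *: th) by rewrite scalerA mulfV// scale1r.
apply: (rhoP `|th|); first lra.
by rewrite /S/= normrZ normfV normr_id mulVf.
Unshelve. all: by end_near. Qed.

(** A minimizer over the closed ball of radius [rho] is global: the ball contains 0, and J > J 0
    outside it. *)
Lemma dual_fun_minimum : exists th0, forall th, J th0 <= J th.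
Proof.
have [rho rho0 rhoP] := dual_fun_coercive.
pose D := [set th : 'rV[R]_r | `|th| <= rho].
have D0 : D 0 by rewrite /D/= normr0 ltW.
have cD : compact D.
  apply: bounded_closed_compact.
    by exists rho; split => [|y y1 th /= /le_trans -> //]; [exact: num_real|exact: ltW].
  apply: (closed_comp (f := fun th : 'rV[R]_r => `|th|) (D := [set x | x <= rho])).
    by move=> th _; exact: norm_continuous.
  exact: closed_le.
have [|th0 _ th0P] := EVT_min_rV (f := J) (ex_intro _ 0 D0) cD.
  exact/continuous_subspaceT/dual_fun_continuous.
exists th0 => th; have [/= hth|/ltW hth] := leP `|th| rho.
  by apply: th0P; rewrite inE.
apply: (@le_trans _ _ (J 0)); first by apply: th0P; rewrite inE.
exact/ltW/rhoP.
Qed.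

(** Instead of differentiating under the integral, J(th0 + t v) is bounded above by J(th0) plus t
    times (I - v.beta) plus a multiple of t^2; minimality then forces the linear coefficient to
    vanish. *)
Lemma dual_fun_stationary : exists th0, forall v,
  \int[mu]_x (expR (dot th0 (g x)) * dot v (g x)) = dot v beta.
Proof.
have [th0 th0P] := dual_fun_minimum; exists th0 => v.
set I := \int[mu]_x _; apply/eqP; rewrite -subr_eq0; apply/eqP.
(* A bound for |v.g|; the added 1 makes it positive, so that 1 / (2 C) makes sense. *)
pose C := 1 + `|r%:R * M * `|v| |.
have C0 : 0 < C by rewrite /C; have := normr_ge0 (r%:R * M * `|v|); lra.
have bC x : `|dot v (g x)| <= C.
  by rewrite (le_trans (dot_bound _ _))// (le_trans (ler_norm _))// /C; lra.
have i1 : mu.-integrable setT (EFin \o (fun x => expR (dot th0 (g x)) * dot v (g x))).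
  by apply: (@integrable_expdotM _ _ C) => //; exact: measurable_dot.
have iZ (c : R) (f : T -> R) : mu.-integrable setT (EFin \o f) ->
    mu.-integrable setT (EFin \o (fun x => c * f x)).
  by move=> /(integrableZl measurableT c).
(* For |t| <= 1 / (2 C) one has |t v.g| <= 1/2, the range of [expR_le_quad]; the quadratic
   coefficient comes from (v.g)^2 <= C^2. *)
apply: (@first_order_eq0 _ ((2 * C)^-1) _ (2 * C ^+ 2 * Z th0)).
- by rewrite invr_gt0 mulr_gt0.
- by rewrite !mulr_ge0// ?partition_fun_ge0 ?exprn_ge0 ?ltW.
move=> t tC; have := th0P (th0 + t *: v); rewrite /dual_fun dotDl dotZl.
suff : Z (th0 + t *: v) <= Z th0 + t * I + t ^+ 2 * (2 * C ^+ 2 * Z th0).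
  by move: (Z (th0 + t *: v)) (Z th0) (I) => z1 z0 i *; lra.
rewrite [t ^+ 2 * _]mulrA /partition_fun /I -!RintegralZl//; last first.
  exact: integrable_expdot.
have i3 : mu.-integrable setT (EFin \o (fun x => expR (dot th0 (g x)) +
    t * (expR (dot th0 (g x)) * dot v (g x)))).
  have := integrableD measurableT (integrable_expdot th0) (iZ t _ i1).
  exact: eq_integrable.
rewrite -RintegralD//; [|exact: integrable_expdot|exact: iZ].
have i4 := iZ (t ^+ 2 * (2 * C ^+ 2)) _ (integrable_expdot th0).
rewrite -RintegralD//.
apply: le_Rintegral => //; first exact: integrable_expdot.
  have := integrableD measurableT i3 i4; exact: eq_integrable.
move=> x _; rewrite dotDl expRD dotZl.
set e := expR (dot th0 _); set w := dot v _.
have e0 : 0 < e by exact: expR_gt0.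
have nw : `|w| <= C by exact: bC.
have tw : `|t * w| <= 2^-1.
  rewrite normrM (le_trans (ler_pM _ _ tC nw))//.
  by rewrite invfM -mulrA mulVf ?gt_eqF// mulr1.
have := expR_le_quad tw; rewrite -(ler_pM2l e0) => /le_trans; apply.
have w2 : w ^+ 2 <= C ^+ 2 by rewrite -real_normK ?num_real// ler_sqr// nnegrE// ltW.
rewrite (_ : t ^+ 2 * _ * e = e * (2 * t ^+ 2 * C ^+ 2)); last by ring.
rewrite (_ : e + _ = e * (1 + t * w)); last by ring.
rewrite -mulrDr ler_pM2l// lerD2l exprMn mulrA; apply: ler_wpM2l => //.
by rewrite mulr_ge0// sqr_ge0.
Qed.

End log_partition.

(** The row space of [B] is the span of the possibly infinite family [h], obtained as a space of
    minimal rank containing it. If [k] kills every [h x], intersecting with its kernel still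
    contains the family, so by minimality nothing is lost. *)
Lemma min_row_space (F : fieldType) (T : Type) (N : nat) (h : T -> 'rV[F]_N) :
  exists (r : nat) (B : 'M[F]_(r, N)),
    [/\ row_free B, forall x, (h x <= B)%MS &
      forall k : 'cV[F]_N, (forall x, h x *m k = 0) -> B *m k = 0].
Proof.
pose P r := `[< exists2 B : 'M[F]_N, forall x, (h x <= B)%MS & \rank B = r >].
have exP : exists r, P r.
  by exists N; apply/asboolP; exists 1%:M; [move=> x; exact: submx1|exact: mxrank1].
have [r /asboolP[W hW rW] rmin] := ex_minnP exP.
exists (\rank W), (row_base W); split.
- exact: row_base_free.
- by move=> x; rewrite eq_row_base.
move=> k hk; apply/eqP; rewrite -sub_kermx eq_row_base.
have hWk x : (h x <= W :&: kermx k)%MS by rewrite sub_capmx hW sub_kermx hk eqxx.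
have := rmin (\rank (W :&: kermx k)) (asboolT (ex_intro2 _ _ _ hWk erefl)).
rewrite -rW => le1.
have /eqmxP e : (W :&: kermx k == W)%MS.
  by rewrite -(mxrank_leqif_eq (capmxSl _ _)) eqn_leq mxrankS ?capmxSl.
by have := capmxSr W (kermx k); rewrite e.
Qed.

(** * Finite measures given by a nonnegative integrable density *)

Section density.
Context d (T : measurableType d) (R : realType).
Variables (mu : {finite_measure set T -> \bar R}) (f : T -> R).
Hypothesis f0 : forall x, 0 <= f x.
Hypothesis intf : mu.-integrable setT (EFin \o f).

(* The proof arguments allow the measure structure to be inferred. *)
Definition density of (forall x, 0 <= f x) & mu.-integrable setT (EFin \o f)
    : set T -> \bar R :=
  fun A => (\int[mu]_(x in A) (f x)%:E)%E.

Local Notation nu := (density f0 intf).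

Let nu0 : nu set0 = 0%E. Proof. exact: integral_set0. Qed.

Let nu_ge0 A : (0 <= nu A)%E.
Proof. by apply: integral_ge0 => x _; rewrite lee_fin. Qed.

Let nu_sigma : semi_sigma_additive nu.
Proof.
apply: semi_sigma_additive_nng_induced; last by move=> x; rewrite lee_fin.
exact: measurable_int intf.
Qed.

HB.instance Definition _ := measure_function.isMeasure.Build _ _ _ nu nu0 nu_ge0 nu_sigma.

Let nu_fin : fin_num_fun nu.
Proof.
by move=> A mA; apply: integrable_fin_num => //; exact: integrableS intf.
Qed.

HB.instance Definition _ := Measure_isFinite.Build _ _ _ nu nu_fin.

Lemma density_dominated : nu `<< mu.
Proof.
apply/null_content_dominatesP => A mA A0.
apply: null_set_integral => //; apply: measurable_funTS.
exact: measurable_int intf.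
Qed.

(** Both functions have the same integral over every measurable set. *)
Lemma density_Radon_Nikodym :
  ae_eq mu setT ('d (charge_of_finite_measure nu) '/d mu) (EFin \o f).
Proof.
apply: integral_ae_eq => //.
- exact/Radon_Nikodym_integrable/density_dominated.
- exact: measurable_int intf.
- move=> A _ mA; rewrite -Radon_Nikodym_integral//; exact: density_dominated.
Qed.

Lemma Rintegral_density (phi : T -> R) (C : R) :
  measurable_fun setT phi -> (forall x, `|phi x| <= C) ->
  \int[nu]_x phi x = \int[mu]_x (f x * phi x).
Proof.
move=> mphi phiC; congr fine.
have iphi : (nu : {finite_measure set T -> \bar R}).-integrable setT (EFin \o phi).
  exact: bounded_integrable mphi phiC.
rewrite -(Radon_Nikodym_change_of_variables density_dominated measurableT iphi).
have mf : measurable_fun setT (EFin \o f) := measurable_int _ intf.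
apply: ae_eq_integral => //.
- apply: emeasurable_funM; first exact/measurable_EFinP.
  apply: measurable_int; apply: Radon_Nikodym_integrable; exact: density_dominated.
- by under eq_fun do rewrite EFinM; apply: emeasurable_funM => //; exact/measurable_EFinP.
- have := density_Radon_Nikodym; apply: filterS => x /= + _ => -> //.
  by rewrite /= muleC EFinM.
Qed.

End density.

(** * Continuity and Borel measurability on the subspace and for polynomials *)

Section borel_subset_theory.
Context {T : topologicalType} {X : set T} {X0 : X !=set0} {R : realType}.

Lemma val_continuous : continuous (fun x : borel_subset X0 => val x : T).
Proof. exact: (@initial_continuous _ _ (fun x : set_type X => val x)). Qed.

Lemma open_borel_measurable (U : set (borel_subset X0)) : open U -> measurable U.
Proof. by move=> oU; exact: sub_sigma_algebra. Qed.

Lemma continuous_borel_measurable (f : borel_subset X0 -> R) :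
  continuous f -> measurable_fun setT f.
Proof.
move=> cf; apply: (measurability _ (RGenOInfty.measurableE R)).
move=> _ [_ [a ->] <-]; rewrite setTI; apply: open_borel_measurable.
by apply: open_comp => // x _; exact: cf.
Qed.

End borel_subset_theory.

Lemma mpoly_continuous (R : realType) (n : nat) (p : mpoly n R) :
  continuous (fun v : 'rV[R]_n => meval (fun j => v ord0 j) p).
Proof.
under eq_fun do rewrite mevalE.
apply: continuous_big => [|k _]; first exact: add_continuous.
have c j : continuous (fun v : 'rV[R]_n => v ord0 j).
  exact: (@coord_continuous R 1 n ord0 j).
have cp : continuous (fun v : 'rV[R]_n => \prod_i v ord0 i ^+ (fun_of_multinom k i)).
  apply: continuous_big => [|i _ v]; first exact: mul_continuous.
  have := continuous_cvg _ (@exprn_continuous _ (fun_of_multinom k i) _) (c i v).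
  exact.
move=> v; have := cvgM (cvg_cst (mcoeff k p)) (cp v); exact.
Qed.

(** * Moments of polynomials and the geometry of the moment cone *)

Section moments_theory.
Context {R : realType} {n : nat} {X : set 'rV[R]_n} {X0 : X !=set0}.

Lemma poly_fun_continuous (p : mpoly n R) :
  continuous (poly_fun p : borel_subset X0 -> R).
Proof.
move=> x.
have := continuous_cvg _ (@mpoly_continuous R n p _) (@val_continuous _ _ X0 x).
exact.
Qed.

Lemma poly_fun_bounded (cX : compact X) (p : mpoly n R) :
  exists C, forall x : borel_subset X0, `|poly_fun p x| <= C.
Proof.
have cp : {within X, continuous (fun v : 'rV[R]_n => meval (fun j => v ord0 j) p)}.
  exact/continuous_subspaceT/mpoly_continuous.
have /compact_bounded[C [_ CP]] := continuous_compact cp cX.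
exists (C + 1) => x; apply: (CP (C + 1)); first by rewrite ltrDl.
by exists (val x) => //; exact: set_valP.
Qed.

Variables (m : nat) (h : 'I_m -> mpoly n R).

Definition poly_row (x : borel_subset X0) : 'rV[R]_m := \row_i poly_fun (h i) x.

Lemma dot_poly_row_continuous (u : 'rV[R]_m) :
  continuous (fun x => dot u (poly_row x)).
Proof.
under eq_fun do rewrite dotE.
apply: continuous_big => [|i _]; first exact: add_continuous.
under eq_fun do rewrite mxE.
move=> x; have := cvgM (cvg_cst (u ord0 i)) (@poly_fun_continuous (h i) x); exact.
Qed.

Lemma poly_row_bounded (cX : compact X) :
  exists2 C, 0 <= C & forall i x, `|poly_row x ord0 i| <= C.
Proof.
have [C CP] := choice (fun i => poly_fun_bounded cX (h i)).
exists (\sum_i `|C i|) => [|i x]; first exact: sumr_ge0.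
rewrite mxE (le_trans (CP i x))// (le_trans (ler_norm _))//.
by rewrite (bigD1 i)//= lerDl sumr_ge0.
Qed.

Lemma dot_moments (cX : compact X) (u : 'rV[R]_m)
    (eta : {finite_measure set (borel_subset X0) -> \bar R}) :
  dot u (moments h eta) = \int[eta]_x dot u (poly_row x).
Proof.
have ih i : eta.-integrable setT (EFin \o (fun x => u ord0 i * poly_fun (h i) x)).
  have [C CP] := poly_fun_bounded cX (h i).
  apply: (@bounded_integrable _ _ _ _ _ (`|u ord0 i| * C)).
    apply: continuous_borel_measurable => x.
    have := cvgM (cvg_cst (u ord0 i)) (@poly_fun_continuous (h i) x); exact.
  by move=> x; rewrite normrM ler_wpM2l.
have ip i : eta.-integrable setT (EFin \o poly_fun (h i)).
  have [C CP] := poly_fun_bounded cX (h i).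
  apply: (@bounded_integrable _ _ _ _ _ C) => //.
  by apply: continuous_borel_measurable => x; exact: poly_fun_continuous.
transitivity (\sum_i \int[eta]_x (u ord0 i * poly_fun (h i) x)).
  by rewrite dotE; apply: eq_bigr => i _; rewrite mxE RintegralZl.
rewrite sum_fine => [|i _]; last exact: integrable_fin_num (ih i).
rewrite -integral_sum//; congr fine; apply: eq_integral => x _.
by rewrite sumEFin dotE; congr EFin; apply: eq_bigr => i _; rewrite mxE.
Qed.

(** Lying in the row space means being annihilated by the columns of [cokermx B]; these linear
    conditions survive integration. *)
Lemma moments_sub_row_space (cX : compact X) (r : nat) (B : 'M[R]_(r, m))
    (eta : {finite_measure set (borel_subset X0) -> \bar R}) :
  (forall x, (poly_row x <= B)%MS) -> (moments h eta <= B)%MS.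
Proof.
move=> hB; rewrite submxE; apply/eqP/rowP => j; rewrite !mxE.
transitivity (dot (col j (cokermx B))^T (moments h eta)).
  by rewrite dotE; apply: eq_bigr => i _; rewrite !mxE mulrC.
rewrite dot_moments//; transitivity (\int[eta]_x (0 : R)); last first.
  by rewrite Rintegral_cst// mul0r.
apply: eq_Rintegral => x _; have := hB x; rewrite submxE => /eqP/rowP/(_ j); rewrite !mxE => e0.
by rewrite dotE -[RHS]e0; apply: eq_bigr => i _; rewrite !mxE mulrC.
Qed.

(** The Dirac measure at [x] represents this point. *)
Lemma poly_row_moments (x : borel_subset X0) : moment_cone X0 h (poly_row x).
Proof.
exists (\d_x : {finite_measure set (borel_subset X0) -> \bar R}) => //.
apply/rowP => i; rewrite !mxE /Rintegral integral_dirac//.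
  by rewrite diracT mul1e.
apply/measurable_EFinP; apply: continuous_borel_measurable.
exact: poly_fun_continuous.
Qed.

(* For small e > 0 the point b + e (b - h(x0)) of the affine hull is still in the
   cone, so that u . b <= e u . (h(x0) - b). *)
Lemma relative_interior_dot_lt0 (cX : compact X) (b u : 'rV[R]_m) x0 :
  relative_interior (moment_cone X0 h) b ->
  (forall x, dot u (poly_row x) <= 0) -> dot u (poly_row x0) < 0 ->
  dot u b < 0.
Proof.
set K := moment_cone X0 h => bK hle hlt.
have Kb : K b := interior_subset bK.
have Ka v : K v -> affine_hull K v.
  move=> Kv; exists 1%N, (fun=> v), (fun=> 1); split => //.
    by rewrite big_ord1.
  by rewrite big_ord1 scale1r.
pose p (e : R) := b + e *: (b - poly_row x0).
(* Affine combination of [b] and [poly_row x0] with weights 1 + e and - e. *)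
have pa e : affine_hull K (p e).
  exists 2%N, (fun i => if i == ord0 then b else poly_row x0),
    (fun i => if i == ord0 then 1 + e else - e); split.
  - by move=> i; case: ifP => _ //; exact: poly_row_moments.
  - by rewrite big_ord_recl big_ord1/= addrK.
  - by rewrite big_ord_recl big_ord1/= /p scalerDl scale1r scalerBr scaleNr addrA.
have cp : p e @[e --> (0 : R)^'+] --> b.
  apply: cvg_at_right_filter.
  have c0 : e *: (b - poly_row x0) @[e --> (0 : R)] --> (0 : R) *: (b - poly_row x0).
    exact: scalel_continuous.
  have := cvgD (cvg_cst b) c0; rewrite scale0r addr0; exact.
have nK : nbhs b [set v | affine_hull K v -> K v].
  by move: bK; rewrite /relative_interior /interior/= /nbhs/= -nbhs_subspace_in//; exact: Ka.
have nKp : \forall e \near (0 : R)^'+, affine_hull K (p e) -> K (p e) := cp _ nK.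
have [e [/(_ (pa e))[eta _ etaE] e0]] : exists e, (affine_hull K (p e) -> K (p e)) /\ 0 < e.
  by apply: (@filter_ex _ (0 : R)^'+); apply: filterI nKp (nbhs_right_gt 0).
have : 0 <= dot (- u) (p e).
  rewrite -etaE dot_moments//; apply: Rintegral_ge0 => x _.
  by rewrite dotNl oppr_ge0.
rewrite dotNl oppr_ge0 /p dotC dotDl dotZl dotBl ![dot _ u]dotC => pe.
(* Rearranged, [pe] says (1 + e) u.b <= e u.h(x0), which is negative. *)
nra.
Qed.

End moments_theory.

(** * Passage to independent coordinates, verification of the dichotomy, and the resulting
    density *)

Theorem theorem5p8 (R : realType) (n m : nat) (X : set 'rV[R]_n)
    (X0 : X !=set0) (cX : compact X)
    (h : 'I_m.+1 -> mpoly n R) (b : 'rV[R]_m.+1)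
    (mu : probability (borel_subset X0) R) (mu_pos : strictly_positive mu)
    (h1 : h ord0 = 1) (b1 : 0 < b ord0 ord0)
    (bK : relative_interior (moment_cone X0 h) b) :
  exists nu : {finite_measure set (borel_subset X0) -> \bar R},
    [/\ forall i, \int[nu]_x poly_fun (h i) x = b ord0 i,
        nu `<< mu
      & exists (c : R) (kappa : 'I_m.+1 -> R), 0 < c /\
          ae_eq mu setT ('d (charge_of_finite_measure nu) '/d mu)
            (fun x => (c * expR (\sum_i kappa i * poly_fun (h i) x))%:E)].
Proof.
pose hx : borel_subset X0 -> 'rV[R]_m.+1 := poly_row h.
have [r [B [freeB hB kerB]]] := min_row_space hx.
(* Coordinates of h(x) and of [b] in the rows of [B]; as [B] is row free, [pinvmx B] is a right
   inverse. *)
pose g x := hx x *m pinvmx B; pose beta := b *m pinvmx B.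
have bB : (b <= B)%MS.
  by have [eta _ <-] := interior_subset bK; exact: moments_sub_row_space.
have hg x i : poly_fun (h i) x = dot (col i B)^T (g x).
  by rewrite -mulmx_rowE mulmxKpV// mxE.
have bg i : b ord0 i = dot (col i B)^T beta by rewrite -mulmx_rowE mulmxKpV.
have mg j : measurable_fun setT (fun x => g x ord0 j).
  under eq_fun do rewrite mulmx_rowE.
  by apply: continuous_borel_measurable => x; exact: dot_poly_row_continuous.
have [M gM] : exists M, forall x, `|g x| <= M.
  have [C C0 CP] := poly_row_bounded h cX.
  have D0 j : 0 <= m.+1%:R * C * `|(col j (pinvmx B))^T| by rewrite !mulr_ge0.
  exists (\sum_j m.+1%:R * C * `|(col j (pinvmx B))^T|) => x.
  apply: mx_norm_le => [|j]; first exact: sumr_ge0.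
  rewrite mulmx_rowE (bigD1 j)//= ler_wpDr ?sumr_ge0//.
  rewrite (le_trans (dot_norm_le _ _))// ler_wpM2r// ler_wpM2l//.
  by apply: mx_norm_le => // i; exact: CP.
have coer th : th != 0 ->
    (exists2 dl : R, 0 < dl & (0 < mu [set x | (dl < dot th (g x))%R])%E) \/
    dot th beta < 0.
  (* The vector [u] is [th] transported to the original coordinates: th.g = u.h and th.beta =
     u.b. *)
  move=> th0; pose u := th *m (pinvmx B)^T.
  have thE x : dot th (g x) = dot u (hx x) by rewrite dot_mulmx.
  have [[x ux]|neg] := pselect (exists x, 0 < dot u (hx x)).
    left; exists (dot u (hx x) / 2); first by rewrite divr_gt0.
    apply: mu_pos; last by exists x; rewrite /= thE; lra.
    under eq_set do rewrite thE.
    apply: (open_comp (f := fun y => dot u (hx y)) (D := [set a | _ < a])).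
      by move=> y _; exact: dot_poly_row_continuous.
    exact: open_gt.
  have hle x : dot u (hx x) <= 0.
    by rewrite leNgt; apply/negP => ux; apply: neg; exists x.
  right; rewrite dot_mulmx -/u.
  have [x0 hx0] : exists x0, dot u (hx x0) < 0.
    apply: contrapT => no; move/negP: th0; apply.
    have z x : dot u (hx x) = 0.
      apply: le_anti; rewrite hle leNgt; apply/negP => ux; apply: no; by exists x.
    (* If u.h vanishes on all of [X], then B u^T = 0; but B u^T = th^T, contradicting th != 0. *)
    have /kerB : forall x, hx x *m u^T = 0.
      by move=> x; apply/rowP => j; rewrite ord1 [RHS]mxE -(z x) dotC.
    rewrite /u trmx_mul trmxK mulmxA mulmxVp// mul1mx => /(congr1 trmx).
    by rewrite trmxK trmx0 => ->.
  exact: relative_interior_dot_lt0 bK hle hx0.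
have [th thP] := dual_fun_stationary mg gM coer.
have f0 x : 0 <= expR (dot th (g x)) by exact: expR_ge0.
exists (density f0 (integrable_expdot mu mg gM th)); split.
- move=> i; have [C CP] := poly_fun_bounded cX (h i).
  rewrite (Rintegral_density _ _ _ CP); last first.
    by apply: continuous_borel_measurable => x; exact: poly_fun_continuous.
  (* Stationarity in the direction given by column [i] of [B] is the i-th moment condition. *)
  by rewrite bg -thP; apply: eq_Rintegral => x _; rewrite hg.
- exact: density_dominated.
(* Stationarity of [J] gives the moments exactly, total mass included, so no rescaling occurs and c
   = 1. *)
exists 1, ((th *m (pinvmx B)^T) ord0); split=> //.
rewrite (_ : (fun x => _) = EFin \o (fun x => expR (dot th (g x)))).
  have := density_Radon_Nikodym f0 (integrable_expdot mu mg gM th); exact.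
apply/funext => x /=; rewrite mul1r dot_mulmx dotE; congr (expR _)%:E.
by apply: eq_bigr => i _; rewrite [hx x _ _]mxE.
Qed.
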